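(* Let $n\ge1$. Every ball in $\mathbb{R}^n$ admits a completely saturated packing with replicas of the ball, whose density is equal to the packing constant $\delta_n$.
   Context: $B(c,t)$ is the closed ball of $\mathbb{R}^n$ with center $c$ and radius $t$. A packing with replicas of a ball of radius $\rho>0$ is a system of balls $\{\lambda+B(0,\rho):\lambda\in\Lambda\}$ where $\Lambda\subset\mathbb{R}^n$ satisfies $\|x-y\|\ge2\rho$ for all distinct $x,y\in\Lambda$ (no overlap of interiors). Its density is $$\limsup_{T\to+\infty}\frac{\mathrm{vol}\big((\bigcup_{\lambda\in\Lambda}(\lambda+B(0,\rho)))\cap B(0,T)\big)}{\mathrm{vol}(B(0,T))}.$$ The packing constant $\delta_n$ is the supremum of the densities of all packings of equal balls of $\mathbb{R}^n$ (it does not depend on the common radius). For an integer $m\ge1$, a packing is $m$-saturated if no finite subsystem of $m-1$ balls of it can be replaced with $m$ replicas of the ball (so that the result is still a packing). A packing is completely saturated if it is $m$-saturated for every $m\ge1$. *)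

(* Defs.v *)
From HB Require Import structures.
From mathcomp Require Import all_boot all_order all_algebra.
From mathcomp Require Import all_classical all_reals all_analysis.

Set Implicit Arguments.
Unset Strict Implicit.
Unset Printing Implicit Defensive.

Import Order.TTheory GRing.Theory Num.Theory.
Import numFieldNormedType.Exports.

Local Open Scope classical_set_scope.
Local Open Scope ring_scope.

Definition cons_pair (R : realType) (n : nat)
    (p : measurableTypeR R * n.-tuple (measurableTypeR R)) :
    n.+1.-tuple (measurableTypeR R) :=
  [tuple of p.1 :: p.2].

(* Lebesgue measure on n-tuples, as an iterated product measure; for n = 0 it
   is the Dirac mass at the empty tuple. *)
Fixpoint lebesgue_tuple (R : realType) (n : nat) :
    set (n.-tuple (measurableTypeR R)) -> \bar R :=
  match n with
  | 0%N => \d_([tuple] : 0.-tuple (measurableTypeR R))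
  | m.+1 => pushforward (@lebesgue_measure R \x @lebesgue_tuple R m)%E
                        (@cons_pair R m)
  end.

Lemma measurable_cons_pair (R : realType) (n : nat) :
  measurable_fun setT (@cons_pair R n).
Proof. exact: measurable_cons. Qed.

Lemma measurable_uncons (R : realType) (n : nat) :
  measurable_fun setT (fun t : n.+1.-tuple (measurableTypeR R) =>
    (thead t, [tuple of behead t])).
Proof.
by apply: measurable_fun_pair; [exact: measurable_tnth|exact: measurable_behead].
Qed.

Section cons_measure.
Variables (R : realType) (n : nat).
Variable m : {sigma_finite_measure set (n.-tuple (measurableTypeR R)) -> \bar R}.

Definition cons_measure : set (n.+1.-tuple (measurableTypeR R)) -> \bar R :=
  pushforward (@lebesgue_measure R \x m)%E (@cons_pair R n).

HB.instance Definition _ := Measure.copy cons_measure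
  (measure_function_pushforward__canonical__measure_function_Measure
     (@lebesgue_measure R \x m)%E (@measurable_cons_pair R n)).

Let cons_measure_sigma_finite : sigma_finite setT cons_measure.
Proof.
have /sigma_finiteP[F [FT ndF Foo]] := sigma_finiteT (@lebesgue_measure R).
have /sigma_finiteP[G [GT ndG Goo]] := sigma_finiteT m.
pose H k := F k `*` G k.
have HT : [set: measurableTypeR R * n.-tuple (measurableTypeR R)] = \bigcup_k H k.
  rewrite -setXTT FT GT predeqE => -[x y]; split; last first.
    by move=> [k _ []/= ? ?]; split; exists k.
  move=> [/= [i _ Fx] [j _ Gy]]; exists (maxn i j) => //; split => /=.
    by move: x Fx; exact/subsetPset/ndF/leq_maxl.
  by move: y Gy; exact/subsetPset/ndG/leq_maxr.
have Hoo k : measurable (H k) /\ ((@lebesgue_measure R \x m) (H k) < +oo)%E.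
  have [mF ?] := Foo k; have [mG ?] := Goo k; split; first exact: measurableX.
  by rewrite product_measure1E// lte_mul_pinfty// ge0_fin_numE.
pose u (t : n.+1.-tuple (measurableTypeR R)) := (thead t, [tuple of behead t]).
exists (fun k => u @^-1` H k); first by rewrite -preimage_bigcup -HT preimage_setT.
move=> k; have [mF Fk] := Hoo k; split.
  by rewrite -[X in measurable X]setTI; exact: measurable_uncons.
rewrite /cons_measure /pushforward (_ : _ @^-1` _ = H k)//.
apply/seteqP; split=> -[x t] /=; rewrite /u /cons_pair theadE/=;
  by rewrite (_ : [tuple of _] = t)//; exact/val_inj.
Qed.

HB.instance Definition _ := Measure_isSigmaFinite.Build _ _ _ cons_measure
  cons_measure_sigma_finite.
End cons_measure.

Lemma lebesgue_tuple_sigma_finite_measure (R : realType) (n : nat) :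
  exists m : {sigma_finite_measure set (n.-tuple (measurableTypeR R)) -> \bar R},
    lebesgue_tuple (n := n) = m.
Proof.
elim: n => [|n [m mE]]; last by exists (cons_measure m); rewrite /= mE.
by exists (\d_([tuple] : 0.-tuple (measurableTypeR R))).
Qed.

Lemma lebesgue_tuple_box (R : realType) (n : nat)
    (A : 'I_n -> set (measurableTypeR R)) : (forall i, measurable (A i)) ->
  lebesgue_tuple [set t | forall i, A i (tnth t i)] =
  (\prod_(i < n) lebesgue_measure (A i))%E.
Proof.
elim: n A => [|n IH] A mA.
  by rewrite big_ord0 /= diracE mem_set// => -[].
have [m mE] := lebesgue_tuple_sigma_finite_measure R n.
pose B : set (n.-tuple (measurableTypeR R)) :=
  [set t | forall i, A (lift ord0 i) (tnth t i)].
have mB : measurable B.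
  rewrite (_ : B = \bigcap_(i in [set: 'I_n])
      ((fun t : n.-tuple (measurableTypeR R) => tnth t i) @^-1` A (lift ord0 i))).
    apply: fin_bigcap_measurable; first exact: finite_finset.
    by move=> i _; rewrite -[X in measurable X]setTI; exact: measurable_tnth.
  by apply/seteqP; split=> t /= h i; [move=> _; exact: h|exact: h].
rewrite big_ord_recl -IH; last by move=> i; exact: mA.
rewrite /= mE /pushforward -product_measure1E//.
congr (_ _); apply/seteqP; split=> -[x t] /=.
  move=> h; split; first by have := h ord0; rewrite tnth0.
  by move=> i; have := h (lift ord0 i); rewrite tnthS.
move=> [Ax h] i; case: (unliftP ord0 i) => [j|] ->; rewrite ?tnthS ?tnth0//.
Qed.

Definition volume (R : realType) (n : nat) (A : set 'rV[R]_n) : \bar R :=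
  lebesgue_tuple [set t | A (\row_i tnth t i)].

(* The Euclidean norm; the library's [`|x|] on row vectors is the sup norm. *)
Definition enorm (R : realType) (n : nat) (x : 'rV[R]_n) : R :=
  Num.sqrt (\sum_(i < n) x ord0 i ^+ 2).

Definition eball (R : realType) (n : nat) (c : 'rV[R]_n) (t : R) :
    set 'rV[R]_n :=
  [set x | enorm (x - c) <= t].

(* A packing [{l + B(0, r)}] is represented by its set [L] of centers. *)
Definition packing (R : realType) (n : nat) (r : R) (L : set 'rV[R]_n) : Prop :=
  forall x y, L x -> L y -> x <> y -> 2 * r <= enorm (x - y).

Definition packing_union (R : realType) (n : nat) (r : R) (L : set 'rV[R]_n) :
    set 'rV[R]_n :=
  \bigcup_(l in L) [set l + x | x in eball 0 r].

Definition density (R : realType) (n : nat) (r : R) (L : set 'rV[R]_n) :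
    \bar R :=
  limf_esup (fun T : R =>
    volume (packing_union r L `&` eball 0 T) / volume (eball (0 : 'rV[R]_n) T))%E
    (pinfty_nbhs R).

Definition packing_constant (R : realType) (n : nat) : \bar R :=
  ereal_sup [set d | exists (r : R) (L : set 'rV[R]_n),
    [/\ 0 < r, packing r L & d = density r L]].

(* [F] is the set of centers of the removed balls and [G] that of their
   replacements. The new balls must be distinct from the balls that are kept:
   otherwise the set-theoretic union would silently absorb a duplicate. *)
Definition saturated (R : realType) (n : nat) (m : nat) (r : R)
    (L : set 'rV[R]_n) : Prop :=
  ~ exists F G : set 'rV[R]_n,
      [/\ F `<=` L, (F #= `I_m.-1)%card, (G #= `I_m)%card,
          (L `\` F) `&` G = set0 & packing r ((L `\` F) `|` G)].

Definition completely_saturated (R : realType) (n : nat) (r : R)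
    (L : set 'rV[R]_n) : Prop :=
  forall m : nat, (0 < m)%N -> saturated m r L.

(* Main.v *)
(* A packing L is completely saturated when no finite modification gains a
   ball.  Such an L has optimal density: inside a ball of radius S + 2r it must
   contain as many centers as any packing of the ball of radius S, since
   otherwise the latter could be swapped in.

   For existence, take a maximal packing P of a huge ball of radius S.  P
   admits no gain, but this is not preserved by limits, as the separation
   condition is closed.  One therefore allows replacements whose outcome is only
   a packing of radius r / (1 + t).  If such replacements of diameter D were
   available on a positive proportion of P, carrying out many of them far apart
   and rescaling by 1 + t would give a packing of the ball of radius (1 + t) S
   with too many centers.  So for a suitable t_D, independent of S, these
   places cover at most a proportion 2^-(D+2) of the volume, and some point
   avoids them for all D < J.  Recentering there and letting J go to infinity
   along an ultrafilter gives L: a gain in L would be, up to an arbitrarily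
   small error, a gain in one of the recentered packings. *)

Require Import Defs.
From mathcomp Require Import all_boot all_order all_algebra.
From mathcomp Require Import finmap.
From mathcomp Require Import all_classical all_reals all_analysis.
From mathcomp Require Import measurable_realfun ring lra.

Set Implicit Arguments.
Unset Strict Implicit.
Unset Printing Implicit Defensive.

Import Order.TTheory GRing.Theory Num.Theory.
Import numFieldNormedType.Exports.

Local Open Scope classical_set_scope.
Local Open Scope ring_scope.

(** * Euclidean norm *)

Section EuclideanNorm.
Variables (R : realType) (n : nat).
Implicit Types (x y c : 'rV[R]_n) (t s : R).

Lemma enorm_ge0 x : 0 <= enorm x.
Proof. exact: sqrtr_ge0. Qed.

Lemma sqr_enorm x : enorm x ^+ 2 = \sum_(i < n) x ord0 i ^+ 2.
Proof. by rewrite sqr_sqrtr// sumr_ge0// => i _; exact: sqr_ge0. Qed.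

Lemma enormN x : enorm (- x) = enorm x.
Proof. by congr Num.sqrt; apply: eq_bigr => i _; rewrite mxE sqrrN. Qed.

Lemma enormB x y : enorm (x - y) = enorm (y - x).
Proof. by rewrite -enormN opprB. Qed.

Lemma enormZ s x : enorm (s *: x) = `|s| * enorm x.
Proof.
rewrite /enorm -sqrtr_sqr -sqrtrM ?sqr_ge0// mulr_sumr.
by congr Num.sqrt; apply: eq_bigr => i _; rewrite mxE exprMn.
Qed.

Lemma enorm0 : enorm (0 : 'rV[R]_n) = 0.
Proof. by rewrite -(scale0r (0 : 'rV[R]_n)) enormZ normr0 mul0r. Qed.

Lemma enorm0_eq0 x : enorm x = 0 -> x = 0.
Proof.
move=> x0; apply/rowP => i; rewrite mxE; apply/eqP; rewrite -sqrf_eq0.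
have /eqP := sqr_enorm x; rewrite x0 expr0n/= eq_sym psumr_eq0; last first.
  by move=> j _; exact: sqr_ge0.
by move=> /allP/(_ i); rewrite mem_index_enum => /(_ isT).
Qed.

(** The sum of the squares [(s * x_i - y_i) ^+ 2] is nonnegative for every [s]; at
    [s = enorm y / enorm x] it is a nonnegative multiple of the gap between the two sides. *)
Lemma cauchy_schwarz x y :
  \sum_(i < n) x ord0 i * y ord0 i <= enorm x * enorm y.
Proof.
have q s : 0 <= s ^+ 2 * enorm x ^+ 2
    - 2 * s * (\sum_(i < n) x ord0 i * y ord0 i) + enorm y ^+ 2.
  have -> : s ^+ 2 * enorm x ^+ 2 - 2 * s * (\sum_(i < n) x ord0 i * y ord0 i)
      + enorm y ^+ 2 = \sum_(i < n) (s * x ord0 i - y ord0 i) ^+ 2.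
    rewrite !sqr_enorm !mulr_sumr -sumrB -big_split/=.
    by apply: eq_bigr => i _; ring.
  by apply: sumr_ge0 => i _; exact: sqr_ge0.
have [/enorm0_eq0 ->|x0] := eqVneq (enorm x) 0.
  by rewrite enorm0 mul0r big1// => i _; rewrite mxE mul0r.
have xp : 0 < enorm x by rewrite lt0r x0 enorm_ge0.
have := q (enorm y / enorm x).
set S := \sum_(i < n) _.
have -> : (enorm y / enorm x) ^+ 2 * enorm x ^+ 2
    - 2 * (enorm y / enorm x) * S + enorm y ^+ 2
   = 2 * enorm y * (enorm x * enorm y - S) / enorm x by field.
have [y0 _|y0] := eqVneq (enorm y) 0.
  by rewrite y0 mulr0 /S (enorm0_eq0 y0) big1// => i _; rewrite mxE mulr0.
have yp : 0 < enorm y by rewrite lt0r y0 enorm_ge0.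
by rewrite pmulr_lge0 ?invr_gt0// pmulr_rge0 ?mulr_gt0// subr_ge0.
Qed.

Lemma ler_enormD x y : enorm (x + y) <= enorm x + enorm y.
Proof.
rewrite -(@ler_pXn2r _ 2)// ?nnegrE ?addr_ge0 ?enorm_ge0//.
have -> : enorm (x + y) ^+ 2 = enorm x ^+ 2 + enorm y ^+ 2
    + 2 * \sum_(i < n) x ord0 i * y ord0 i.
  rewrite !sqr_enorm mulr_sumr -!big_split/=.
  by apply: eq_bigr => i _; rewrite !mxE; ring.
have := cauchy_schwarz x y; lra.
Qed.

Lemma ler_edistD c x y : enorm (x - y) <= enorm (x - c) + enorm (c - y).
Proof. by rewrite (le_trans _ (ler_enormD _ _))// addrA subrK. Qed.

Lemma coord_le_enorm x i : `|x ord0 i| <= enorm x.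
Proof.
rewrite -(@ler_pXn2r _ 2)// ?nnegrE ?enorm_ge0// sqr_enorm real_normK ?num_real//.
by rewrite (bigD1 i)//= lerDl sumr_ge0// => j _; exact: sqr_ge0.
Qed.

Lemma enorm_le_coord x s : (forall i, `|x ord0 i| <= s) -> enorm x <= n%:R * s.
Proof.
(* For [n = 0] the hypothesis is vacuous and [s] may be negative. *)
move=> xs; have [n0|n0] := posnP n.
  rewrite /enorm big1 ?sqrtr0 ?n0 ?mul0r// => i _.
  by have := ltn_ord i; rewrite [X in (_ < X)%N]n0.
have s0 : 0 <= s by rewrite (le_trans _ (xs (Ordinal n0))).
rewrite -(@ler_pXn2r _ 2)// ?nnegrE ?enorm_ge0 ?mulr_ge0//.
rewrite sqr_enorm exprMn.
have -> : n%:R ^+ 2 * s ^+ 2 = \sum_(i < n) n%:R * s ^+ 2.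
  by rewrite sumr_const card_ord -mulr_natl expr2; ring.
apply: ler_sum => i _.
rewrite -real_normK ?num_real// (@le_trans _ _ (s ^+ 2))//.
  by rewrite ler_pXn2r ?nnegrE.
by rewrite ler_peMl ?sqr_ge0// ler1n.
Qed.

Lemma mx_norm_le_enorm x : `|x| <= enorm x.
Proof.
rewrite /Num.norm/= mx_normrE; apply/bigmax_leP; split => [|[i j] _].
  exact: enorm_ge0.
by rewrite ord1; exact: coord_le_enorm.
Qed.

Lemma enorm_le_mx_norm x : enorm x <= n%:R * `|x|.
Proof.
apply: enorm_le_coord => i; rewrite [leRHS]/Num.norm/= mx_normrE.
by apply/bigmax_geP; right => /=; exists (ord0, i).
Qed.

End EuclideanNorm.

(** * Affine change of variables *)

Section AffineChange.
Variable R : realType.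

Lemma measurable_affine (s c : R) :
  measurable_fun [set: measurableTypeR R]
    (fun x : measurableTypeR R => c + s * x : measurableTypeR R).
Proof.
by apply: measurable_funD.
Qed.

(** Uniqueness of Lebesgue measure: the pushforward scaled by [s] gives each half-open interval its
    length. *)
Lemma lebesgue_measure_affine (s c : R) (A : set (measurableTypeR R)) :
  0 < s -> measurable A ->
  lebesgue_measure A =
  (s%:E * lebesgue_measure ((fun x : R => c + s * x)%R @^-1` A))%E.
Proof.
move=> s0 mA; pose k : {nonneg R} := NngNum (ltW s0).
pose nu := mscale k
  (measure_function_pushforward__canonical__measure_function_Measure
  (@lebesgue_measure R) (measurable_affine s c)).
apply: (@lebesgue_measure_unique _ nu) => // _ [[a b]] _ <-.
rewrite /nu/= /mscale/= /pushforward.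
rewrite (_ : _ @^-1` _ = `](a - c) / s, (b - c) / s]%classic); last first.
  apply/seteqP; split => x /=; rewrite !in_itv/=.
    by rewrite ltr_pdivrMr// ler_pdivlMr// ltrBlDl lerBrDl mulrC.
  by rewrite ltr_pdivrMr// ler_pdivlMr// ltrBlDl lerBrDl mulrC.
rewrite !lebesgue_measure_itv/= !lte_fin ltr_pM2r ?invr_gt0// ltrD2r.
case: ifPn => _; last by rewrite mule0.
by rewrite -!EFinD -EFinM; congr EFin; field; rewrite gt_eqF.
Qed.

Definition affine_tuple n (s : R) (c : 'rV[R]_n)
    (u : n.-tuple (measurableTypeR R)) : n.-tuple (measurableTypeR R) :=
  [tuple c ord0 i + s * tnth u i | i < n].

Lemma measurable_affine_tuple n (s : R) (c : 'rV[R]_n) :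
  measurable_fun setT (affine_tuple s c).
Proof.
apply/measurable_fun_tnthP => i.
rewrite (_ : _ \o _ = (fun x : measurableTypeR R => c ord0 i + s * x) \o
  (fun u : n.-tuple (measurableTypeR R) => tnth u i)); last first.
  by apply/funext => u /=; rewrite tnth_mktuple.
by apply: measurableT_comp; [exact: measurable_affine|exact: measurable_tnth].
Qed.

(** Induction on the dimension: [c] splits into its first coordinate and the rest, and both sides
    are measures that agree on rectangles, which determines a product measure. *)
Lemma lebesgue_tuple_affine n (s : R) (c : 'rV[R]_n)
    (A : set (n.-tuple (measurableTypeR R))) : 0 < s -> measurable A ->
  lebesgue_tuple A = ((s ^+ n)%:E * lebesgue_tuple (affine_tuple s c @^-1` A))%E.
Proof.
move=> s0; elim: n c A => [|n IH] c A mA.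
  rewrite expr0 mul1e; congr lebesgue_tuple; apply/seteqP.
  by split => u /=; rewrite [affine_tuple _ _ _]tuple0 [u]tuple0.
have [m mE] := lebesgue_tuple_sigma_finite_measure R n.
pose c0 := c ord0 ord0; pose c' : 'rV[R]_n := \row_i c ord0 (lift ord0 i).
pose g (p : measurableTypeR R * n.-tuple (measurableTypeR R)) :
    measurableTypeR R * n.-tuple (measurableTypeR R) :=
  (c0 + s * p.1, affine_tuple s c' p.2).
have mg : measurable_fun setT g.
  apply: measurable_fun_pair.
    exact: (measurableT_comp (measurable_affine s c0) (@measurable_fst _ _ _ _)).
  exact: (measurableT_comp (@measurable_affine_tuple n s c')
    (@measurable_snd _ _ _ _)).
pose k : {nonneg R} := NngNum (ltW (exprn_gt0 n.+1 s0)).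
pose nu := mscale k
  (measure_function_pushforward__canonical__measure_function_Measure
  (@lebesgue_measure R \x m)%E mg).
rewrite /= mE /pushforward.
rewrite (@product_measure_unique _ _ _ _ _ _ _ nu); last 2 first.
- move=> B C mB mC; rewrite /nu/= /mscale/= /pushforward.
  rewrite (_ : g @^-1` _ = ((fun x => c0 + s * x) @^-1` B) `*`
                           (affine_tuple s c' @^-1` C))//.
  have maB : measurable ((fun x : measurableTypeR R => c0 + s * x) @^-1` B).
    by rewrite -[X in measurable X]setTI; exact: (measurable_affine s c0).
  have maC : measurable (affine_tuple s c' @^-1` C).
    by rewrite -[X in measurable X]setTI; exact: (measurable_affine_tuple s c').
  rewrite product_measure1E// -mE (IH c' C)// (@lebesgue_measure_affine s c0 B)//.
  by rewrite exprS EFinM muleACA.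
- by rewrite -[X in measurable X]setTI; exact: measurable_cons_pair.
rewrite /nu/= /mscale/= /pushforward; congr (_ * _)%E; congr (_ _).
apply/seteqP; split => -[x u] /=; rewrite /g/=;
  congr A; apply: eq_from_tnth => i;
  rewrite /cons_pair !(tnth_mktuple, tnth0, tnthS)//;
  by case: (unliftP ord0 i) => [j|] ->;
    rewrite ?tnth0 ?tnthS ?tnth_mktuple ?mxE ?tnth0 ?tnthS.
Qed.

End AffineChange.

(** * Volumes of balls *)

Lemma bernoulli_le (R : realDomainType) (x : R) n :
  x <= 1 -> 1 - n%:R * x <= (1 - x) ^+ n.
Proof.
move=> x1; elim: n => [|n IH]; first by rewrite mul0r subr0 expr0.
rewrite exprS (@le_trans _ _ ((1 - x) * (1 - n%:R * x)))//.
  rewrite -natr1; have : 0 <= n%:R * x ^+ 2 by rewrite mulr_ge0// sqr_ge0.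
  rewrite expr2; lra.
by rewrite ler_wpM2l// subr_ge0.
Qed.

(** Crude but linear in [x]: with [c = 3 ^ n], the induction absorbs [x + c * x + c * x ^+ 2] into
    [3 * c * x]. *)
Lemma exprD1_le (R : realDomainType) (x : R) n :
  0 <= x <= 1 -> (1 + x) ^+ n <= 1 + (3 ^ n)%:R * x.
Proof.
move=> /andP[x0 x1]; elim: n => [|n IH]; first by rewrite expr0 lerDl mulr_ge0.
rewrite exprS expnS natrM (@le_trans _ _ ((1 + x) * (1 + (3 ^ n)%:R * x)))//.
  by rewrite ler_wpM2l// addr_ge0.
have c1 : 1 <= (3 ^ n)%:R :> R by rewrite ler1n expn_gt0.
have : 0 <= (3 ^ n)%:R * x * (1 - x) by rewrite !mulr_ge0 ?subr_ge0.
by have : 0 <= ((3 ^ n)%:R - 1) * x; [rewrite mulr_ge0 ?subr_ge0|nra].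
Qed.

Section Volume.
Variables (R : realType) (n : nat).
Local Notation V := 'rV[R]_n.
Implicit Types (A B : set V) (c : V) (t : R).

(** The sigma-algebra lives on tuples; [volume A] is the measure of this set. *)
Definition tuple_set A : set (n.-tuple (measurableTypeR R)) :=
  [set u | A (\row_i tnth u i)].

Definition vmeasurable A := measurable (tuple_set A).

Lemma vmeasurableI A B : vmeasurable A -> vmeasurable B -> vmeasurable (A `&` B).
Proof. exact: measurableI. Qed.

Lemma vmeasurableD A B : vmeasurable A -> vmeasurable B -> vmeasurable (A `\` B).
Proof. exact: measurableD. Qed.

Lemma tuple_set_bigcup I (D : set I) (F : I -> set V) :
  tuple_set (\bigcup_(i in D) F i) = \bigcup_(i in D) tuple_set (F i).
Proof. by []. Qed.

Lemma vmeasurable_bigcup (I : choiceType) (P : {fset I}) (F : I -> set V) :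
  (forall i, i \in P -> vmeasurable (F i)) ->
  vmeasurable (\bigcup_(i in [set` P]) F i).
Proof.
move=> mF; rewrite /vmeasurable tuple_set_bigcup.
by apply: fin_bigcup_measurable.
Qed.

Lemma vmeasurable_eball c t : vmeasurable (eball c t).
Proof.
rewrite /vmeasurable /tuple_set /eball /= -[X in measurable X]setTI.
apply: measurable_fun_le => //.
apply: (@measurableT_comp _ _ _ _ _ _ (@Num.sqrt R)).
  by apply: continuous_measurable_fun; exact: sqrt_continuous.
apply: measurable_sum => i; apply: measurable_funX.
rewrite (_ : (fun _ => _) =
    (fun u : n.-tuple (measurableTypeR R) => tnth u i - c ord0 i)); last first.
  by apply/funext => u; rewrite !mxE.
by apply: measurable_funB => //; exact: measurable_tnth.
Qed.

Lemma le_volume A B : vmeasurable A -> vmeasurable B -> A `<=` B ->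
  (volume A <= volume B)%E.
Proof.
move=> mA mB AB; have [m mE] := lebesgue_tuple_sigma_finite_measure R n.
rewrite /volume mE; apply: le_measure; rewrite ?inE// => u; exact: AB.
Qed.

Lemma volume_ge0 A : vmeasurable A -> (0 <= volume A)%E.
Proof.
by move=> mA; have [m mE] := lebesgue_tuple_sigma_finite_measure R n;
  rewrite /volume mE.
Qed.

Lemma volume_bigcup_le (I : choiceType) (P : {fset I}) (F : I -> set V) A :
  (forall i, i \in P -> vmeasurable (F i)) -> vmeasurable A ->
  A `<=` \bigcup_(i in [set` P]) F i ->
  (volume A <= \sum_(i <- P) volume (F i))%E.
Proof.
move=> mF mA AF; have [m mE] := lebesgue_tuple_sigma_finite_measure R n.
rewrite /volume mE fsbig_seq//; apply: content_sub_fsum => //.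
by rewrite -tuple_set_bigcup => u; exact: AF.
Qed.

Lemma volume_bigcup (I : choiceType) (P : {fset I}) (F : I -> set V) :
  (forall i, i \in P -> vmeasurable (F i)) -> trivIset [set` P] F ->
  volume (\bigcup_(i in [set` P]) F i) = (\sum_(i <- P) volume (F i))%E.
Proof.
move=> mF tF; have [m mE] := lebesgue_tuple_sigma_finite_measure R n.
rewrite /volume mE fsbig_seq//.
rewrite -(@measure_fin_bigcup _ _ _ m _ _ (tuple_set \o F))//.
move=> i j Pi Pj [u [Fi Fj]]; apply: (tF i j) => //.
by exists (\row_k tnth u k).
Qed.

Lemma volume_eball_scale c t : 0 < t ->
  volume (eball c t) = ((t ^+ n)%:E * volume (eball (0 : V) 1))%E.
Proof.
move=> t0; rewrite /volume (@lebesgue_tuple_affine _ _ t c)//; last first.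
  exact: vmeasurable_eball.
congr (_ * lebesgue_tuple _)%E; apply/seteqP.
have E (u : n.-tuple (measurableTypeR R)) :
    enorm (\row_i tnth (affine_tuple t c u) i - c) = t * enorm (\row_i tnth u i - 0).
  rewrite -[t in RHS]gtr0_norm// -enormZ subr0; congr enorm.
  by apply/rowP => i; rewrite !mxE tnth_mktuple addrC addKr.
by split => u /=; rewrite /eball/= E mulrC -ler_pdivlMr// divff ?gt_eqF.
Qed.

Lemma volume_cube t : 0 <= t ->
  volume [set x : V | forall i, `|x ord0 i| <= t] = ((2 * t) ^+ n)%:E.
Proof.
move=> t0; rewrite /volume.
rewrite (_ : [set _ | _] =
    [set u : n.-tuple (measurableTypeR R) |
      forall i, `[- t, t]%classic (tnth u i)]); last first.
  by apply/seteqP; split=> u /= h i; have := h i; rewrite in_itv/= mxE ler_norml.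
rewrite (@lebesgue_tuple_box _ _ (fun=> `[- t, t]%classic))//.
rewrite (eq_bigr (fun=> (2 * t)%:E)) => [|i _].
  by rewrite prodEFin prodr_const card_ord.
rewrite lebesgue_measure_itv/= lte_fin; case: ifPn => [_|].
  by rewrite -EFinD; congr EFin; ring.
by rewrite -leNgt => tt; congr EFin; lra.
Qed.

Definition unit_ball_volume := fine (volume (eball (0 : V) 1)).

Lemma vmeasurable_cube t : vmeasurable [set x : V | forall i, `|x ord0 i| <= t].
Proof.
rewrite /vmeasurable (_ : tuple_set _ = \bigcap_(i in [set: 'I_n])
  ((fun u : n.-tuple (measurableTypeR R) => tnth u i) @^-1` `[- t, t]%classic)).
  apply: fin_bigcap_measurable; first exact: finite_finset.
  by move=> i _; rewrite -[X in measurable X]setTI; exact: measurable_tnth.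
apply/seteqP; split=> u /= h i; have := h i;
  by rewrite /= in_itv/= mxE ler_norml// => /(_ Logic.I).
Qed.

Lemma unit_ball_volumeE : volume (eball (0 : V) 1) = unit_ball_volume%:E.
Proof.
rewrite /unit_ball_volume fineK// ge0_fin_numE ?volume_ge0//; last first.
  exact: vmeasurable_eball.
apply: (@le_lt_trans _ _ ((2 * 1) ^+ n)%:E); last exact: ltry.
rewrite -volume_cube//; apply: le_volume.
- exact: vmeasurable_eball.
- exact: vmeasurable_cube.
- move=> x; rewrite /eball/= subr0 => x1 i.
  exact: le_trans (coord_le_enorm _ _) x1.
Qed.

Lemma unit_ball_volume_gt0 : 0 < unit_ball_volume.
Proof.
rewrite -lte_fin -unit_ball_volumeE.
(* The cube of half-side [1 / (n + 1)] fits in the unit ball. *)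
apply: (@lt_le_trans _ _ ((2 * n.+1%:R^-1) ^+ n)%:E).
  by rewrite lte_fin exprn_gt0// mulr_gt0// invr_gt0.
rewrite -volume_cube//; apply: le_volume.
- exact: vmeasurable_cube.
- exact: vmeasurable_eball.
- move=> x /= h; rewrite /eball/= subr0 (le_trans (enorm_le_coord h))//.
  by rewrite ler_pdivrMr// mul1r ler_nat.
Qed.

Lemma volume_eball c t : 0 < t ->
  volume (eball c t) = (t ^+ n * unit_ball_volume)%:E.
Proof. by move=> t0; rewrite volume_eball_scale// unit_ball_volumeE -EFinM. Qed.

Lemma volume_eball_cover (P : {fset V}) t A : 0 < t -> vmeasurable A ->
  A `<=` \bigcup_(p in [set` P]) eball p t ->
  (volume A <= (#|` P|%:R * (t ^+ n * unit_ball_volume))%:E)%E.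
Proof.
move=> t0 mA AP.
apply: le_trans (volume_bigcup_le (fun p _ => vmeasurable_eball p t) mA AP) _.
rewrite (eq_bigr (fun=> (t ^+ n * unit_ball_volume)%:E)) => [|p _]; last first.
  exact: volume_eball.
by rewrite sumEFin big_const_seq count_predT iter_addr_0 mulr_natl.
Qed.

Lemma volume_packing (P : {fset V}) (r a : R) A : 0 < r -> packing r [set` P] ->
  vmeasurable A -> volume A = a%:E -> (forall p, p \in P -> eball p r `<=` A) ->
  #|` P|%:R * (r ^+ n * unit_ball_volume) <= a.
Proof.
move=> r0 Pr mA vA PA; set K := _ * _.
have K0 : 0 <= K.
  by rewrite !mulr_ge0// ?exprn_ge0 ?(ltW r0)// (ltW unit_ball_volume_gt0).
(* The balls of radius [r] may touch, those of radius [(1 - e) * r] are disjoint. *)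
have main e : 0 < e -> e < 1 -> (1 - e) ^+ n * K <= a.
  move=> e0 e1; pose s := (1 - e) * r.
  have s0 : 0 < s by rewrite mulr_gt0// subr_gt0.
  have sr : s < r by rewrite /s -[ltRHS]mul1r ltr_pM2r// ltrBlDr ltrDl.
  suff : (volume (\bigcup_(p in [set` P]) eball p s) <= a%:E)%E.
    rewrite volume_bigcup; last first.
    - move=> p q Pp Pq [x []]; rewrite /eball/= => xp xq.
      apply: contrapT => /(Pr _ _ Pp Pq); apply/negP; rewrite -ltNge.
      have := ler_edistD x p q; rewrite [enorm (p - x)]enormB; lra.
    - by move=> p _; exact: vmeasurable_eball.
    rewrite (eq_bigr (fun=> (s ^+ n * unit_ball_volume)%:E)) => [|p _]; last first.
      exact: volume_eball.
    rewrite sumEFin big_const_seq count_predT iter_addr_0 lee_fin -[leLHS]mulr_natl.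
    by apply: le_trans; rewrite /K /s exprMn le_eqVlt; apply/orP; left;
      apply/eqP; ring.
  rewrite -vA; apply: le_volume => //.
    by apply: vmeasurable_bigcup => p _; exact: vmeasurable_eball.
  move=> x [p Pp]; rewrite /eball/= => xp; apply: (PA p) => //.
  by rewrite /eball/= (le_trans xp)// ltW.
rewrite leNgt; apply/negP => aK.
have {}K0 : 0 < K.
  by rewrite (le_lt_trans _ aK)// -lee_fin -vA volume_ge0.
(* By Bernoulli's inequality, shrinking by this [e] costs at most [(K - a) / 2] out of [K], which
   leaves more than [a]. *)
pose e := (K - a) / (K * n.+2%:R * 2).
have a0 : 0 <= a by rewrite -lee_fin -vA volume_ge0.
have Kn : 0 < K * n.+2%:R * 2 by do 2 apply: mulr_gt0 => //.
have e0 : 0 < e.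
  by rewrite divr_gt0 ?subr_gt0.
have n2 : 2 <= n.+2%:R :> R by rewrite ler_nat.
have e1 : e < 1.
  rewrite ltr_pdivrMr// mul1r; nra.
have := main e e0 e1; apply/negP; rewrite -ltNge.
apply: (@lt_le_trans _ _ ((1 - n%:R * e) * K)).
  have : n%:R * e * K <= (K - a) / 2.
    have -> : n%:R * e * K = (n%:R / n.+2%:R) * ((K - a) / 2).
      have N0 : n.+2%:R != 0 :> R by rewrite pnatr_eq0.
      have KN0 : K != 0 by rewrite gt_eqF.
      move: N0 KN0; rewrite /e; move: n.+2%:R => N N0 KN0.
      by field; rewrite N0 KN0.
    rewrite ler_piMl ?divr_ge0 ?subr_ge0 ?(ltW aK)//.
    by rewrite ler_pdivrMr// mul1r ler_nat ltnW.
  lra.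
by rewrite ler_pM2r// bernoulli_le// ltW.
Qed.

End Volume.

(** * Replacements *)

Section Replacement.
Variables (R : realType) (n : nat).
Local Notation V := 'rV[R]_n.
Local Notation v := (unit_ball_volume R n).
Implicit Types (A L : set V) (P Q X F G : {fset V}) (x y p : V) (r D S t : R).

Lemma packing_le r r' L : r' <= r -> packing r L -> packing r' L.
Proof.
by move=> rr PL x y Lx Ly xy; rewrite (le_trans _ (PL x y Lx Ly xy))// ler_pM2l.
Qed.

Lemma packing_sub r L L' : L' `<=` L -> packing r L -> packing r L'.
Proof. by move=> LL PL x y Lx Ly; apply: PL; exact: LL. Qed.

Lemma eball_sub x D S : eball 0 (S - D) x -> eball x D `<=` eball 0 S.
Proof.
move=> xS p; move: xS; rewrite /eball/= => xS px.
by have := ler_edistD x p 0; lra.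
Qed.

Lemma card_packing_bound r S P : 0 < r -> 0 < S -> packing r [set` P] ->
  [set` P] `<=` eball 0 S -> #|` P|%:R * r ^+ n <= (S + r) ^+ n.
Proof.
move=> r0 S0 PP PS; have := @volume_packing _ _ P r _ (eball 0 (S + r)) r0 PP
  (vmeasurable_eball _ _) (volume_eball _ (addr_gt0 S0 r0)).
rewrite mulrA ler_pM2r ?unit_ball_volume_gt0//; apply => p Pp.
by apply: eball_sub; rewrite addrK; exact: PS.
Qed.

(** Maximal in the number of centers, not merely for inclusion, so that no replacement within [A]
    can gain a ball. *)
Definition max_packing r A P :=
  [/\ packing r [set` P], [set` P] `<=` A &
    forall Q, packing r [set` Q] -> [set` Q] `<=` A -> (#|` Q| <= #|` P|)%N].

Lemma exists_max_packing r S A : 0 < r -> A `<=` eball 0 S ->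
  exists P, max_packing r A P.
Proof.
move=> r0 AS.
(* [S] may be nonpositive, while the volume bound on the number of centers needs a positive
   radius. *)
pose S' := Num.max S 1; have S0 : 0 < S' by rewrite lt_max ltr01 orbT.
pose pr k := `[< exists P, [/\ packing r [set` P], [set` P] `<=` A & #|` P| = k] >].
have ex : exists k, pr k.
  exists 0%N; apply/asboolP; exists fset0; split => //.
have bd k : pr k -> (k <= Num.bound ((S' + r) ^+ n / r ^+ n))%N.
  move=> /asboolP[P [PP PA <-]]; rewrite -(ler_nat R) ltW//.
  apply: le_lt_trans (archi_boundP _); last first.
    by rewrite divr_ge0// exprn_ge0// ?addr_ge0// ltW.
  rewrite ler_pdivlMr ?exprn_gt0//; apply: card_packing_bound => // x /PA/AS.
  by rewrite /eball/= => /le_trans; apply; rewrite le_max lexx.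
case: (ex_maxnP ex bd) => k /asboolP[P [PP PA <-]] mx; exists P; split => //.
by move=> Q PQ QA; apply: mx; apply/asboolP; exists Q.
Qed.

(** A point of [A] outside these balls could be added to [P]. *)
Lemma max_packing_cover r A P : 0 < r -> max_packing r A P ->
  A `<=` \bigcup_(p in [set` P]) eball p (2 * r).
Proof.
move=> r0 [PP PA mx] x Ax; apply: contrapT => nx.
have far p : p \in P -> 2 * r < enorm (x - p).
  by move=> Pp; rewrite ltNge; apply/negP => h; apply: nx; exists p.
have xP : x \notin P.
  by apply/negP => /far; rewrite subrr enorm0 ltNge mulr_ge0// ltW.
have := mx (x |` P)%fset; rewrite cardfsU1 xP/= add1n ltnn => h.
apply: notF; apply: h => //.
  move=> y z; rewrite /= !in_fset1U => /orP[/eqP->|Py] /orP[/eqP->|Pz] yz //.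
  - by rewrite ltW// far.
  - by rewrite enormB ltW// far.
  - exact: PP.
by move=> y /=; rewrite in_fset1U => /orP[/eqP->//|]; exact: PA.
Qed.

(* A gain of one ball inside [eball x D].  The last condition makes [G] disjoint
   from [L `\` F]; points of [L] are not compared with each other, since [L]
   will be a packing for a larger radius than [r]. *)
Definition replaceable r D L x := exists F G,
  [/\ [set` F] `<=` L `&` eball x D, [set` G] `<=` eball x D,
      #|` G| = #|` F|.+1, packing r [set` G] &
      forall g p, g \in G -> L p -> p \notin F -> 2 * r <= enorm (p - g)].

Lemma replaceable_translate r D L x c :
  replaceable r D [set p | L (p + c)] x -> replaceable r D L (x + c).
Proof.
have ti : injective (fun p : V => p + c) by exact: addIr.
move=> [F [G [FL GD FG PG GF]]].
exists [fset (p + c)%R | p in F]%fset, [fset (p + c)%R | p in G]%fset; split.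
- move=> _ /imfsetP[p /= /FL[Lp pD] ->]; split => //.
  by move: pD; rewrite /eball/= opprD addrACA subrr addr0.
- move=> _ /imfsetP[p /= /GD + ->].
  by rewrite /eball/= opprD addrACA subrr addr0.
- by rewrite !card_imfset.
- move=> _ _ /imfsetP[p /= Gp ->] /imfsetP[q /= Gq ->] pq.
  rewrite opprD addrACA subrr addr0; apply: PG => //.
  by move=> e; apply: pq; rewrite e.
- move=> _ p /imfsetP[g /= Gg ->] Lp pF.
  rewrite opprD addrA -(addrAC p); apply: GF => //=; first by rewrite subrK.
  by apply: contra pF => pF; apply/imfsetP; exists (p - c); rewrite ?subrK.
Qed.

Lemma simultaneous_replacement (r r' D S : R) P (s : seq V) :
  0 < r' -> r' <= r -> packing r [set` P] -> [set` P] `<=` eball 0 S ->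
  uniq s ->
  (forall x, x \in s -> eball 0 (S - D) x /\ replaceable r' D [set` P] x) ->
  (forall x y, x \in s -> y \in s -> x <> y -> 2 * D + 2 * r <= enorm (x - y)) ->
  exists Q, [/\ packing r' [set` Q], [set` Q] `<=` eball 0 S &
    #|` Q| = (#|` P| + size s)%N].
Proof.
move=> r'0 rr PP PS us sP sd.
(* Replacements at distinct centers do not interact: [Q] differs from [P] only
   in the balls [eball x D]. *)
suff [Q [PQ QS QP _ _]] : exists Q, [/\ packing r' [set` Q], [set` Q] `<=` eball 0 S,
    #|` Q| = (#|` P| + size s)%N,
    (forall q, q \in Q -> q \in P \/ exists2 x, x \in s & eball x D q) &
    (forall p, p \in P -> (forall x, x \in s -> ~ eball x D p) -> p \in Q)].
  by exists Q.
elim: s us sP sd => [_ _ _|x s IH /= /andP[xs us] sP sd].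
  exists P; split => //; first exact: packing_le PP.
  - by rewrite addn0.
  - by move=> q; left.
have [| |Q [PQ QS QP Qsub Qsup]] := IH us.
- by move=> y ys; apply: sP; rewrite in_cons ys orbT.
- by move=> y z ys zs; apply: sd; rewrite in_cons ?ys ?zs orbT.
have [xS [F [G [FL GD FG PG GF]]]] := sP x (mem_head _ _).
(* The separation [2 * D + 2 * r] of the centers leaves [2 * r] between the two balls of radius
   [D]. *)
have sx y p q : y \in s -> eball y D p -> eball x D q -> 2 * r <= enorm (p - q).
  move=> ys; rewrite /eball/= => py qx.
  have xy : x <> y by move=> xy; move: xs; rewrite xy ys.
  have := sd x y (mem_head _ _); rewrite in_cons ys orbT => /(_ isT xy).
  have := ler_edistD q x y; have := ler_edistD p q y.
  rewrite [enorm (x - q)]enormB [enorm (q - p)]enormB; lra.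
have FP f : f \in F -> f \in P by move=> /FL[].
have FQ f : f \in F -> f \in Q.
  move=> fF; apply: Qsup; first exact: FP.
  move=> y ys fy; have [_ fx] := FL f fF.
  have := sx y f f ys fy fx; rewrite subrr enorm0; apply/negP.
  by rewrite -ltNge mulr_gt0// (lt_le_trans r'0).
(* An old center is handled by replaceability at [x], a center created earlier by the distance
   between the balls. *)
have QG q g : q \in Q -> q \notin F -> g \in G -> 2 * r' <= enorm (q - g).
  move=> /Qsub[qP|[y ys qy]] qF gG; first exact: GF.
  apply: le_trans (sx y q g ys qy (GD _ gG)).
  by rewrite ler_pM2l.
exists ((Q `\` F) `|` G)%fset; split.
- move=> p q /=; rewrite !in_fsetU !in_fsetD.
  move=> /orP[/andP[pF pQ]|pG] /orP[/andP[qF qQ]|qG] pq.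
  + exact: PQ.
  + exact: QG.
  + by rewrite enormB; exact: QG.
  + exact: PG.
- move=> p /=; rewrite in_fsetU in_fsetD => /orP[/andP[_ /QS]//|/GD].
  exact: eball_sub.
- have dis : [disjoint (Q `\` F)%fset & G]%fset.
    apply/fdisjointP => q; rewrite in_fsetD => /andP[qF qQ]; apply/negP => qG.
    have := QG q q qQ qF qG; rewrite subrr enorm0; apply/negP.
    by rewrite -ltNge mulr_gt0.
  rewrite cardfsU (eqP dis) cardfs0 subn0 cardfsD FG.
  rewrite (_ : Q `&` F = F)%fset; last by apply/fsetIidPr/fsubsetP => f /FQ.
  have FQc : (#|` F| <= #|` Q|)%N by apply/fsubset_leq_card/fsubsetP => f /FQ.
  by rewrite addnS subnK// QP addnS.
- move=> q; rewrite in_fsetU in_fsetD => /orP[/andP[_ /Qsub[]]|qG].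
  + by left.
  + by move=> [y ys qy]; right; exists y => //; rewrite in_cons ys orbT.
  + by right; exists x; [exact: mem_head|exact: GD].
- move=> p pP px; rewrite in_fsetU in_fsetD; apply/orP; left; apply/andP; split.
    by apply/negP => /FL[_]; apply: px; exact: mem_head.
  by apply: Qsup => // y ys; apply: px; rewrite in_cons ys orbT.
Qed.

End Replacement.

(** * Packings without approximate replacements *)

Section GoodPackings.
Variables (R : realType) (n : nat).
Local Notation V := 'rV[R]_n.
Local Notation v := (unit_ball_volume R n).
Implicit Types (A L : set V) (P Q X F G : {fset V}) (x y p : V) (r D S t : R).

Lemma volume_annulus (a b : R) : 0 < b -> b <= a ->
  volume (eball (0 : V) a `\` eball 0 b) = ((a ^+ n - b ^+ n) * v)%:E.
Proof.
move=> b0 ba; have a0 : 0 < a by exact: lt_le_trans ba.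
have [m mE] := lebesgue_tuple_sigma_finite_measure R n.
have vE A : volume A = m (tuple_set A) by rewrite /volume mE.
have := volume_eball (0 : V) a0; have := volume_eball (0 : V) b0.
rewrite !vE => vb va.
have -> : tuple_set (eball (0 : V) a `\` eball 0 b) =
  tuple_set (eball (0 : V) a) `\` tuple_set (eball (0 : V) b) by [].
rewrite measureD//; last 3 first.
- exact: vmeasurable_eball.
- exact: vmeasurable_eball.
- by rewrite [X in (X < _)%E]va ltry.
have -> : tuple_set (eball (0 : V) a) `&` tuple_set (eball (0 : V) b) =
    tuple_set (eball (0 : V) b).
  by apply/setIidPr => u; rewrite /tuple_set /eball/= => /le_trans; exact.
by rewrite [X in (X - _)%E]va [X in (_ - X)%E]vb -EFinB mulrBl.
Qed.

(* [(1 + t) *: Q] is a packing of radius [r]; its points outside [eball 0 S] lie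
   in a thin annulus, and there are few of them by volume. *)
Lemma card_shrunk_packing (r t S : R) P Q : 0 < r -> 0 < t -> t <= 1 / 2 ->
  r <= t * S -> max_packing r (eball 0 S) P ->
  packing (r / (1 + t)) [set` Q] -> [set` Q] `<=` eball 0 S ->
  #|` Q|%:R * r ^+ n <= #|` P|%:R * r ^+ n + t * (2 * 3 ^ n + n)%:R * S ^+ n.
Proof.
move=> r0 t0 t2 rS [_ _ Pmax] PQ QS.
have t1 : 0 < 1 + t by rewrite addr_gt0.
have S0 : 0 < S by have := lt_le_trans r0 rS; rewrite pmulr_rgt0.
have tS : t * S <= 1 / 2 * S by rewrite ler_pM2r.
pose Q1 := [fset ((1 + t) *: q)%R | q in Q]%fset.
have Q1Q : #|` Q1| = #|` Q|.
  by rewrite card_imfset//; apply: scalerI; rewrite gt_eqF.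
have PQ1 : packing r [set` Q1].
  move=> _ _ /imfsetP[p /= pQ ->] /imfsetP[q /= qQ ->] pq.
  rewrite -scalerBr enormZ gtr0_norm//.
  have := PQ p q pQ qQ; rewrite mulrA ler_pdivrMr// [_ * (1 + t)]mulrC; apply.
  by move=> e; apply: pq; rewrite e.
(* The dilated centers that stay in the ball compete with [P], which is maximal. *)
pose I := [fset q in Q1 | enorm q <= S]%fset.
have IP : (#|` I| <= #|` P|)%N.
  apply: Pmax.
    by apply: packing_sub PQ1 => x /=; rewrite !inE/= => /andP[].
  by move=> x /=; rewrite !inE/= /eball/= subr0 => /andP[].
pose O := (Q1 `\` I)%fset.
have OE q : q \in O -> q \in Q1 /\ S < enorm q.
  by rewrite /O /I !inE/= negb_and => /andP[/orP[/negPf->//|] + ->]; rewrite -ltNge.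
have PO : packing r [set` O] by apply: packing_sub PQ1 => x /= /OE[].
(* The balls of radius [r] around [O] lie between the radii [S - r] and [(1 + t) * S + r]. *)
have b0 : 0 < S - r by lra.
have ba : S - r <= (1 + t) * S + r by nra.
have /= := volume_packing r0 PO _ (volume_annulus b0 ba).
rewrite mulrA ler_pM2r ?unit_ball_volume_gt0// => Obd.
have QPO : #|` Q|%:R <= #|` P|%:R + #|` O|%:R :> R.
  have IQ1 : (I `<=` Q1)%fset by apply/fsubsetP => x; rewrite !inE/= => /andP[].
  rewrite -natrD ler_nat -Q1Q -(cardfsID I Q1) leq_add2r.
  by rewrite (_ : Q1 `&` I = I)%fset//; apply/fsetIidPr.
apply: (@le_trans _ _ ((#|` P|%:R + #|` O|%:R) * r ^+ n)).
  by rewrite ler_wpM2r// exprn_ge0// ltW.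
rewrite mulrDl lerD2l (le_trans (Obd _ _))//.
- by apply: vmeasurableD; exact: vmeasurable_eball.
- move=> p /OE[/imfsetP[q /= qQ ->] qS] x; rewrite /eball/= => xq; split.
    have := QS q qQ; rewrite /eball/= !subr0 => q_S.
    have := ler_edistD ((1 + t) *: q) x 0; rewrite !subr0 !enormZ gtr0_norm//.
    have : (1 + t) * enorm q <= (1 + t) * S by rewrite ler_pM2l.
    lra.
  apply/negP; rewrite -ltNge subr0.
  have := ler_edistD x ((1 + t) *: q) 0; rewrite !subr0 [enorm (_ - x)]enormB.
  by rewrite /= in qS *; lra.
(* Here [r <= t * S] makes the annulus proportional to [S]. As [2 * t <= 1], linear bounds on the
   two powers then give the constant [2 * 3 ^ n + n]. *)
apply: (@le_trans _ _ (((1 + 2 * t) * S) ^+ n - ((1 - t) * S) ^+ n)).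
  by apply: lerB; apply: lerXn2r; rewrite ?nnegrE; lra.
rewrite !exprMn -mulrBl ler_pM2r ?exprn_gt0//.
have : (1 + 2 * t) ^+ n <= 1 + (3 ^ n)%:R * (2 * t).
  by apply: exprD1_le; apply/andP; split; lra.
have : 1 - n%:R * t <= (1 - t) ^+ n by apply: bernoulli_le; lra.
rewrite natrD natrM; lra.
Qed.

(* [C] is the union of the balls of radius [2 * (D + r)] centered at a maximal
   system of mutually independent replacements. *)
Lemma replaceable_cover (r D e : R) : 0 < r -> 0 <= D -> 0 < e ->
  exists t S0, [/\ 0 < t, 0 < S0 & forall S P, S0 <= S ->
    max_packing r (eball 0 S) P ->
    exists C : set V, [/\ vmeasurable C, (volume C <= (e * S ^+ n * v)%:E)%E &
      forall x, eball 0 (S - D) x -> replaceable (r / (1 + t)) D [set` P] x -> C x]].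
Proof.
move=> r0 D0 e0; pose c : R := (2 * 3 ^ n + n)%:R.
have c0 : 0 < c by rewrite ltr0n addn_gt0 muln_gt0 expn_gt0.
pose q := (2 * (D + r)) ^+ n / r ^+ n.
have Dr0 : 0 < D + r by rewrite ltr_wpDl.
have q0 : 0 < q by rewrite divr_gt0// exprn_gt0// mulr_gt0.
(* The gain is at most [t * c * S ^+ n / r ^+ n] balls, and each center in [X] accounts for
   [q * r ^+ n] of volume, in units of [v]; so [t * c * q <= e] is wanted. *)
pose t := Num.min (1 / 2) (e / (c * q)).
have t0 : 0 < t by rewrite lt_min !divr_gt0// mulr_gt0.
have t2 : t <= 1 / 2 by rewrite ge_min lexx.
have te : t * (c * q) <= e.
  have cq0 : 0 < c * q by rewrite mulr_gt0.
  by rewrite -ler_pdivlMr// /t ge_min lexx orbT.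
exists t, (r / t); split => //; first by rewrite divr_gt0.
move=> S P S0 Pmax; have rS : r <= t * S by rewrite mulrC -ler_pdivrMr.
have Spos : 0 < S by exact: lt_le_trans (divr_gt0 r0 t0) S0.
have t1 : 0 < 1 + t by rewrite addr_gt0.
pose B := [set x : V | eball 0 (S - D) x /\ replaceable (r / (1 + t)) D [set` P] x].
(* Packing with radius [D + r] is exactly the separation that simultaneous replacements require. *)
have [|X Xmax] := @exists_max_packing _ _ (D + r) S B Dr0.
  move=> x [xS _]; apply: (eball_sub xS).
  by rewrite /eball/= subrr enorm0.
exists (\bigcup_(x in [set` X]) eball x (2 * (D + r))).
have mC : vmeasurable (\bigcup_(x in [set` X]) eball x (2 * (D + r))).
  by apply: vmeasurable_bigcup => x _; exact: vmeasurable_eball.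
split => //; last first.
  by move=> x xS xP; apply: (max_packing_cover Dr0 Xmax).
have [PX XB _] := Xmax; have [PP PS _] := Pmax.
have [|||||| |Q [PQ QS Qc]] := @simultaneous_replacement _ _ r (r / (1 + t)) D S P X.
- by rewrite divr_gt0.
- by rewrite ler_pdivrMr// ler_peMr ?(ltW r0)// lerDl ltW.
- exact: PP.
- exact: PS.
- exact: fset_uniq.
- by move=> x /XB.
- by move=> x y xX yX xy; rewrite -mulrDr; exact: PX.
have := card_shrunk_packing r0 t0 t2 rS Pmax PQ QS.
rewrite Qc natrD mulrDl lerD2l -/c => Xbd.
have R0 : 0 < 2 * (D + r) by rewrite mulr_gt0.
apply: le_trans (volume_eball_cover R0 mC (@subset_refl _ _)) _.
rewrite lee_fin mulrA ler_pM2r ?unit_ball_volume_gt0//.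
have -> : #|` X|%:R * (2 * (D + r)) ^+ n = #|` X|%:R * r ^+ n * q.
  by rewrite /q -mulrA [r ^+ n * _]mulrC divfK// expf_neq0// gt_eqF.
apply: (@le_trans _ _ (t * c * S ^+ n * q)); first by rewrite ler_pM2r.
have -> : t * c * S ^+ n * q = t * (c * q) * S ^+ n by ring.
by rewrite ler_pM2r// exprn_gt0.
Qed.

Lemma packing_translate r L c : packing r L -> packing r [set p | L (p + c)].
Proof.
move=> PL x y Lx Ly xy; rewrite (_ : x - y = (x + c) - (y + c)); last first.
  by rewrite opprD addrACA subrr addr0.
by apply: PL => // /addIr.
Qed.

(** The slacks [t j] are fixed before [J], so they survive the limit. The places replaceable at
    scale [j] take at most a fraction [2 ^- j.+2] of a large ball, less than half over all [j < J];
    a point that avoids them becomes the origin. *)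
Lemma exists_irreplaceable_packings r : 0 < r ->
  exists t : nat -> R, (forall j, 0 < t j) /\
    forall J, exists L, packing r L /\
      forall j, (j < J)%N -> ~ replaceable (r / (1 + t j)) j%:R L (0 : V).
Proof.
move=> r0.
have /choice[f fP] : forall j : nat, exists tS : R * R,
  [/\ 0 < tS.1, 0 < tS.2 & forall S P, tS.2 <= S -> max_packing r (eball 0 S) P ->
    exists C : set V, [/\ vmeasurable C,
      (volume C <= ((2 ^- j.+2) * S ^+ n * v)%:E)%E &
      forall x, eball 0 (S - j%:R) x ->
        replaceable (r / (1 + tS.1)) j%:R [set` P] x -> C x]].
  move=> j; have [||t [S0 [t0 S00 h]]] := @replaceable_cover r j%:R (2 ^- j.+2) r0.
  - by [].
  - by rewrite invr_gt0 exprn_gt0.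
  - by exists (t, S0).
exists (fun j => (f j).1); split => [j|J]; first by have [] := fP j.
(* Above every threshold [(f j).2] with [j < J], and above [2 * n * J] so that shrinking the radius
   by [J] loses at most half of the volume. *)
pose S : R := \sum_(j < J) (f j).2 + (2 * n * J + J + 1)%:R.
have f0 j : 0 <= (f j).2 by have [_ /ltW] := fP j.
have SJ : (2 * n * J + J + 1)%:R <= S by rewrite lerDr sumr_ge0.
have SJ1 : (2 * n * J + J + 1)%:R = 2 * (n%:R * J%:R) + J%:R + 1 :> R.
  by rewrite !natrD !natrM mulrA.
have nJ0 : 0 <= n%:R * J%:R :> R by rewrite mulr_ge0.
have J0 : 0 <= J%:R :> R by [].
have S0 : 0 < S by lra.
have fS j : (j < J)%N -> (f j).2 <= S.
  move=> jJ; rewrite /S (bigD1 (Ordinal jJ))//= -addrA lerDl addr_ge0//.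
  by rewrite sumr_ge0.
have [P Pmax] := @exists_max_packing _ n r S (eball 0 S) r0 (@subset_refl _ _).
have Sn0 : 0 < S ^+ n * v by rewrite mulr_gt0 ?exprn_gt0// unit_ball_volume_gt0.
(* The coefficient is the sum of [2 ^- j.+2] over [j < K]. *)
have H K : (K <= J)%N -> exists C : set V, [/\ vmeasurable C,
    (volume C <= ((2 ^- 1 - 2 ^- K.+1) * (S ^+ n * v))%:E)%E &
    forall j x, (j < K)%N -> eball 0 (S - j%:R) x ->
        replaceable (r / (1 + (f j).1)) j%:R [set` P] x -> C x].
  elim: K => [_|K IH KJ].
    exists set0; split => //; first exact: measurable0.
    by rewrite subrr mul0r /volume (_ : [set _ | _] = set0)//
      (proj2_sig (cid (lebesgue_tuple_sigma_finite_measure R n))) measure0.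
  have [C [mC vC CP]] := IH (ltnW KJ).
  have [_ _ /(_ S P (fS K KJ) Pmax)[C' [mC' vC' CP']]] := fP K.
  exists (C `|` C'); split.
  - exact: measurableU.
  - have [m mE] := lebesgue_tuple_sigma_finite_measure R n.
    apply: (@le_trans _ _ (volume C + volume C')%E).
      rewrite /volume mE.
      by apply: (@measureU2 _ _ _ m (tuple_set C) (tuple_set C')).
    apply: le_trans (leeD vC vC') _.
    rewrite -EFinD lee_fin -mulrA -mulrDl ler_pM2r// !exprS !invfM.
    by move: (2 ^+ K)^-1 => z; lra.
  - move=> j x; rewrite ltnS leq_eqVlt => /orP[/eqP->|jK] xS xP.
      by right; exact: CP'.
    by left; exact: (CP j).
have [C [mC vC CP]] := H J (leqnn J).
have [x xS xC] : exists2 x, eball 0 (S - J%:R) x & ~ C x.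
  apply: contrapT => nx.
  have sub : eball 0 (S - J%:R) `<=` C.
    by move=> x xS; apply: contrapT => xC; apply: nx; exists x.
  have SJ0 : 0 < S - J%:R by lra.
  have := le_trans (le_volume (vmeasurable_eball 0 (S - J%:R)) mC sub) vC.
  rewrite volume_eball// lee_fin mulrA ler_pM2r ?unit_ball_volume_gt0//.
  apply/negP; rewrite -ltNge.
  have -> : S - J%:R = (1 - J%:R / S) * S by field; rewrite gt_eqF.
  rewrite exprMn ltr_pM2r ?exprn_gt0//.
  apply: (@lt_le_trans _ _ (1 - n%:R * (J%:R / S))); last first.
    by apply: bernoulli_le; rewrite ler_pdivrMr//; lra.
  have : n%:R * (J%:R / S) <= 2^-1.
    by rewrite mulrA ler_pdivrMr//; lra.
  have : 0 < 2 ^- J.+1 :> R by rewrite invr_gt0 exprn_gt0.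
  by rewrite expr1; lra.
exists [set p | [set` P] (p + x)]; split.
  by apply: packing_translate; case: Pmax.
move=> j jJ /replaceable_translate; rewrite add0r => xP; apply: xC.
apply: (CP j) => //; move: xS; rewrite /eball/= => /le_trans; apply.
by rewrite lerD2l lerN2 ler_nat ltnW.
Qed.

End GoodPackings.

(** * Ultralimits of packings *)

Section UltraLimit.
Variables (R : realType) (n : nat).
Local Notation V := 'rV[R]_n.
Implicit Types (A L : set V) (P Q X F G : {fset V}) (x y z p : V) (r D S t e : R).

Lemma nbhs_enorm z e : 0 < e -> nbhs z [set y : V | enorm (y - z) < e].
Proof.
move=> e0; apply/nbhs_ballP; exists (e / n.+1%:R) => /=; first by rewrite divr_gt0.
move=> y; rewrite -ball_normE/= => zy; rewrite enormB.
apply: (le_lt_trans (enorm_le_mx_norm _)).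
apply: (@le_lt_trans _ _ (n.+1%:R * `|z - y|)); first by rewrite ler_wpM2r// ler_nat.
by rewrite mulrC -ltr_pdivlMr.
Qed.

Lemma compact_norm_le t : compact [set x : V | `|x| <= t].
Proof.
apply: bounded_closed_compact.
  exists t; split=> [|M tM x /= /le_trans]; first exact: num_real.
  by apply; exact: ltW.
apply: (@closed_comp _ _ (fun x : V => `|x|) [set y | y <= t]);
  last exact: closed_le.
by move=> x _; exact: norm_continuous.
Qed.

(** The points approached by the sets [L k] along [U]; an ultrafilter replaces the extraction of
    convergent subsequences. *)
Definition ultralimit (U : set_system nat) (L : nat -> set V) : set V :=
  [set z | forall e, 0 < e -> U [set k | exists2 y, L k y & enorm (y - z) < e]].

Lemma packing_ultralimit (U : set_system nat) (L : nat -> set V) r :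
  UltraFilter U -> (forall k, packing r (L k)) -> packing r (ultralimit U L).
Proof.
move=> UU PL z w Lz Lw zw; rewrite leNgt; apply/negP => d.
(* The first bound keeps the approximants of [z] and [w] distinct, the second keeps them closer than
   [2 * r]. *)
pose e := Num.min (enorm (z - w) / 2) ((2 * r - enorm (z - w)) / 2).
have zw0 : 0 < enorm (z - w).
  rewrite lt0r enorm_ge0 andbT; apply/eqP => /enorm0_eq0 /eqP.
  by rewrite subr_eq0 => /eqP.
have e0 : 0 < e by rewrite lt_min !divr_gt0// subr_gt0.
have e1 : e <= enorm (z - w) / 2 by rewrite ge_min lexx.
have e2 : e <= (2 * r - enorm (z - w)) / 2 by rewrite ge_min lexx orbT.
have [k [[y Ly yz] [x Lx xw]]] := filter_ex (filterI (Lz e e0) (Lw e e0)).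
have yx : y <> x.
  move=> yx; move: xw; rewrite -yx => xw.
  by have := ler_edistD y z w; rewrite [enorm (z - y)]enormB; lra.
have := PL k y x Ly Lx yx.
have := ler_edistD z y x; have := ler_edistD w z x.
by rewrite [enorm (w - x)]enormB; lra.
Qed.

(** By compactness: bounded points of the [L k] that stay [e] away from the limit set would cluster
    at a point which belongs to it. *)
Lemma near_ultralimit (U : set_system nat) (L : nat -> set V) S e :
  UltraFilter U -> 0 < e ->
  U [set k | forall p, L k p -> enorm p <= S ->
    exists2 z, ultralimit U L z & enorm (p - z) < e].
Proof.
move=> UU e0.
have [//|bad] := in_ultra_setVsetC [set k | forall p, L k p -> enorm p <= S ->
    exists2 z, ultralimit U L z & enorm (p - z) < e] UU.
have /choice[f fP] k : exists p, ~ (forall p, L k p -> enorm p <= S ->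
    exists2 z, ultralimit U L z & enorm (p - z) < e) ->
    [/\ L k p, enorm p <= S & forall z, ultralimit U L z -> e <= enorm (p - z)].
  have [h|nh] := pselect (exists p, [/\ L k p, enorm p <= S &
      forall z, ultralimit U L z -> e <= enorm (p - z)]).
    by have [p ?] := h; exists p.
  (* An arbitrary value for the [k] that have no bad point. *)
  exists 0; case => p Lp pS; apply: contrapT => nz; apply: nh; exists p; split => //.
  by move=> z Lz; rewrite leNgt; apply/negP => pz; apply: nz; exists z.
have FK : U [set k | `|f k| <= S].
  apply: filterS bad => k /= /fP[_ + _].
  by rewrite /=; apply: le_trans; exact: mx_norm_le_enorm.
have [z [_ zf]] := @compact_norm_le S (f @ U) _ FK.
(* Along an ultrafilter, a cluster point is a limit. *)
have Uz d : 0 < d -> U [set k | enorm (f k - z) < d].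
  move=> d0; have [//|Uc] := in_ultra_setVsetC [set k | enorm (f k - z) < d] UU.
  have [x [/= + xz]] := zf (~` [set y | enorm (y - z) < d]) _ Uc (nbhs_enorm z d0).
  by move=> /(_ xz).
have Lz : ultralimit U L z.
  move=> d d0; apply: filterS (filterI bad (Uz d d0)) => k [/= /fP[Lk _ _] fz].
  by exists (f k).
have [k [/= /fP[_ _ /(_ z Lz)]]] := filter_ex (filterI bad (Uz e e0)).
by move=> ez /(le_lt_trans ez); rewrite ltxx.
Qed.

(** A replacement in the limit is carried to some [L k] by moving [F] to nearby centers of [L k] and
    keeping [G]; the slack between [r] and [r / (1 + t j)] pays for the error. *)
Lemma ultralimit_irreplaceable (U : set_system nat) (L : nat -> set V)
    (t : nat -> R) r D : UltraFilter U -> \oo `<=` U -> 0 < r ->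
  (forall j, 0 < t j) -> (forall k, packing r (L k)) ->
  (forall k j, (j < k)%N -> ~ replaceable (r / (1 + t j)) j%:R (L k) 0) ->
  ~ replaceable r D (ultralimit U L) 0.
Proof.
move=> UU oU r0 t0 PL nL [F [G [FL GD FG PG GF]]].
(* The extra [1] leaves room for the displaced points of [F]; [j] depends on [D] alone, so the slack
   is known before [k] is chosen. *)
pose j := Num.bound (`|D| + 1).
have jD : D + 1 <= j%:R.
  rewrite (@le_trans _ _ (`|D| + 1))//; first by rewrite lerD2r ler_norm.
  by rewrite ltW// archi_boundP// addr_ge0.
have tj1 : 0 < 1 + t j by rewrite addr_gt0.
pose rj := r / (1 + t j).
have rj0 : 0 < rj by rewrite divr_gt0.
have rjr : rj < r by rewrite ltr_pdivrMr// ltr_pMr// ltrDl.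
(* The bound [1] keeps the displaced points in the ball of radius [j], [r / 2] makes nearby centers
   unique, and [r - rj] preserves the separation from [G]. *)
pose e := Num.min 1 (Num.min (r / 2) (r - rj)).
have e0 : 0 < e by rewrite !lt_min ltr01 divr_gt0//= subr_gt0.
have e1 : e <= 1 by rewrite ge_min lexx.
have e2 : e <= r / 2 by rewrite !ge_min lexx !orbT.
have e3 : e <= r - rj by rewrite !ge_min lexx !orbT.
have PUL := packing_ultralimit UU PL.
have UF : U (\bigcap_(f in [set` F])
    [set k | exists2 y, L k y & enorm (y - f) < e]).
  by apply: filter_bigI => f /FL[Lf _]; exact: Lf.
have [k [[/= kF near_k] jk]] := filter_ex (filterI
  (filterI UF (@near_ultralimit U L (j%:R + 2 * r) e UU e0))
  (oU _ (nbhs_infty_gt j))).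
have /choice[g gP] f : exists y, f \in F -> L k y /\ enorm (y - f) < e.
  have [fF|fF] := boolP (f \in F); last by exists 0.
  by have [y Ly yf] := kF f fF; exists y.
apply: (nL k j jk); exists [fset g f | f in F]%fset, G; split.
- move=> _ /imfsetP[f /= fF ->]; have [Lg gf] := gP f fF; split => //.
  have [_] := FL f fF; rewrite /eball/= => f0.
  by rewrite (le_trans (ler_edistD f (g f) 0))//; lra.
- by move=> y /GD; rewrite /eball/= => /le_trans; apply; lra.
- rewrite FG card_in_imfset// => f f' fF fF' gg.
  apply: contrapT => ff; have := PUL f f' (FL f fF).1 (FL f' fF').1 ff.
  have [_ gf] := gP f fF; have [_ gf'] := gP f' fF'.
  have := ler_edistD (g f) f f'; rewrite (enormB f (g f)).
  by move: gf'; rewrite -gg; lra.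
- exact: packing_le (ltW rjr) PG.
(* Beyond [j + 2 * r], a center is too far from [G] to interfere; closer in, it is near some limit
   point [z]. *)
- move=> y p yG Lp pF; have [pS|Sp] := leP (enorm p) (j%:R + 2 * r); last first.
    have := GD y yG; rewrite /eball/= subr0 => yD.
    by have := ler_edistD y p 0; rewrite !subr0 -/rj; lra.
  have [z Lz pz] := near_k p Lp pS.
  (* If [z] were in [F], then [p] and [g z] would both be near [z], hence equal. *)
  have zF : z \notin F.
    apply: contra pF => zF; apply/imfsetP; exists z => //=.
    apply: contrapT => pg; have [Lg gz] := gP z zF.
    have := PL k p (g z) Lp Lg pg.
    by have := ler_edistD z p (g z); rewrite [enorm (z - _)]enormB; lra.
  have := GF y z yG Lz zF; have := ler_edistD p z y.
  by rewrite [enorm (z - p)]enormB -/rj; lra.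
Qed.

(** A forbidden replacement involves finitely many centers, so it fits in a ball around the origin;
    the sum of all their norms serves as its radius. *)
Lemma irreplaceable_saturated r L : 0 < r -> packing r L ->
  (forall D, ~ replaceable r D L 0) -> completely_saturated r L.
Proof.
move=> r0 PL nL m m0 [F [G [FL Fm Gm FG PFG]]].
have finF : finite_set F by exists m.-1.
have finG : finite_set G by exists m.
have [P FP] := finite_fsetP.1 finF; have [Q GQ] := finite_fsetP.1 finG.
move: Fm Gm; rewrite FP GQ => /card_eq_fsetP Pm /card_eq_fsetP Qm.
pose D := \sum_(x <- P) enorm x + \sum_(x <- Q) enorm x.
have sum_ge (X : {fset V}) x : x \in X -> enorm x <= \sum_(x <- X) enorm x.
  move=> xX; rewrite (big_rem x)//= lerDl sumr_ge0// => i _; exact: enorm_ge0.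
have sum0 (X : {fset V}) : 0 <= \sum_(x <- X) enorm x.
  by apply: sumr_ge0 => i _; exact: enorm_ge0.
apply: (nL D); exists P, Q; split.
- move=> x xP; split; first by apply: FL; rewrite FP.
  by rewrite /eball/= subr0 (le_trans (sum_ge _ _ xP))// lerDl.
- move=> x xQ; rewrite /eball/= subr0 (le_trans (sum_ge _ _ xQ))// lerDr//.
- by rewrite Pm Qm prednK.
- by apply: packing_sub PFG; rewrite GQ; exact: subsetUr.
- move=> g p gQ Lp pP; apply: PFG.
  + by left; split => //; rewrite FP => /= /(negP pP).
  + by right; rewrite GQ.
  (* Kept and new centers are distinct because they form disjoint sets. *)
  + move=> pg; have : set0 p by rewrite -FG; split;
      [split => //; rewrite FP => /= /(negP pP)|rewrite GQ pg].
    by [].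
Qed.

Lemma exists_completely_saturated r : 0 < r ->
  exists L : set V, packing r L /\ completely_saturated r L.
Proof.
move=> r0; have [t [t0 tP]] := @exists_irreplaceable_packings _ n r r0.
have /choice[L LP] := tP.
have [U [UU oU]] := ultraFilterLemma eventually_filter.
have PL k : packing r (L k) by case: (LP k).
exists (ultralimit U L); split; first exact: packing_ultralimit.
apply: irreplaceable_saturated => //; first exact: packing_ultralimit.
move=> D; apply: (@ultralimit_irreplaceable U L t) => // k j jk.
by have [_] := LP k; exact.
Qed.

End UltraLimit.

(** * Density of completely saturated packings *)

Section Density.
Variables (R : realType) (n : nat).
Local Notation V := 'rV[R]_n.
Local Notation v := (unit_ball_volume R n).
Implicit Types (A L : set V) (P Q X F G : {fset V}) (x y z p : V) (r D S T t e : R).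

(** A largest finite packing inside [L] and the ball exhausts them, since any remaining point could
    be added. *)
Lemma packing_finite_eball r L S : 0 < r -> packing r L ->
  exists Q, [set` Q] = L `&` eball 0 S.
Proof.
move=> r0 PL; have sub : L `&` eball 0 S `<=` eball 0 S by move=> x [].
have [Q [PQ QL Qmax]] := exists_max_packing r0 sub.
exists Q; apply/seteqP; split => // x xL; rewrite /=; apply: contrapT => /negP xQ.
have := Qmax (x |` Q)%fset; rewrite cardfsU1 xQ/= add1n ltnn => h.
have sub' : [set` (x |` Q)%fset] `<=` L `&` eball 0 S.
  by move=> y /=; rewrite in_fset1U => /orP[/eqP->//|]; exact: QL.
by apply: notF; apply: h => //; apply: packing_sub PL => y /sub'[].
Qed.

(** Otherwise centers of [P] could replace all of [Q] with a gain; the margin [2 * r] separates them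
    from the centers of [L] that stay. *)
Lemma saturated_card_ge r L S P Q : 0 < r -> completely_saturated r L ->
  packing r L -> packing r [set` P] -> [set` P] `<=` eball 0 S ->
  [set` Q] = L `&` eball 0 (S + 2 * r) -> (#|` P| <= #|` Q|)%N.
Proof.
move=> r0 sL PL PP PS QL; rewrite leqNgt; apply/negP => QP.
(* Saturation speaks of a gain of exactly one, so [P] is truncated. *)
pose G := [fset x in take #|` Q|.+1 P]%fset.
have GP x : x \in G -> x \in P by rewrite !inE/=; exact: mem_take.
have Gc : #|` G| = #|` Q|.+1.
  rewrite /G card_fseq undup_id ?take_uniq ?fset_uniq//.
  by rewrite size_take_min; apply/minn_idPl.
have QL' x : x \in Q -> L x by move=> xQ; have [+ _] : (L `&` eball 0 (S + 2 * r)) x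
  by rewrite -QL.
have far x y : (L `\` [set` Q]) x -> y \in G -> 2 * r < enorm (x - y).
  move=> [Lx xQ] /GP/PS; rewrite /eball/= => yS.
  have : S + 2 * r < enorm (x - 0).
    rewrite ltNge; apply/negP => xS; apply: xQ.
    by have : (L `&` eball 0 (S + 2 * r)) x by []; rewrite -QL.
  by have := ler_edistD y x 0; lra.
apply: (sL #|` Q|.+1) => //; exists [set` Q], [set` G]; split.
- by move=> x /QL'.
- exact/card_eq_fsetP.
- exact/card_eq_fsetP.
- rewrite -subset0 => x [xL /= xG]; have := far x x xL xG.
  by rewrite subrr enorm0 ltNge mulr_ge0// ltW.
- move=> x y [xL|/= xG] [yL|/= yG] xy.
  + by apply: PL xy; [case: xL|case: yL].
  + by rewrite ltW// far.
  + by rewrite enormB ltW// far.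
  + by apply: PP xy; exact: GP.
Qed.

(** Only balls centered within [T + r] meet [eball 0 T], which reduces the union to a finite one. *)
Lemma packing_union_eball r L T Q : [set` Q] = L `&` eball 0 (T + r) ->
  packing_union r L `&` eball 0 T =
  (\bigcup_(p in [set` Q]) eball p r) `&` eball 0 T.
Proof.
move=> QL; rewrite QL; apply/seteqP; split => x [].
  move=> [l Ll [y]]; rewrite /eball/= subr0 => yr <- lyT; split => //.
  exists l; last by rewrite /= addrAC subrr add0r.
  split => //; rewrite /= subr0; rewrite subr0 in lyT.
  rewrite -(addrK y l) (le_trans (ler_enormD _ _))// enormN; exact: lerD.
move=> [l [Ll _] xr] xT; split => //; exists l => //; exists (x - l).
  by rewrite /eball/= subr0.
by rewrite addrC subrK.
Qed.

Lemma vmeasurable_packing_union r L T : 0 < r -> packing r L ->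
  vmeasurable (packing_union r L `&` eball 0 T).
Proof.
move=> r0 PL; have [Q QL] := packing_finite_eball (T + r) r0 PL.
rewrite (packing_union_eball QL); apply: vmeasurableI; last exact: vmeasurable_eball.
by apply: vmeasurable_bigcup => p _; exact: vmeasurable_eball.
Qed.

Definition covered_volume r L T := fine (volume (packing_union r L `&` eball 0 T)).

Lemma covered_volumeE r L T : 0 < r -> 0 < T -> packing r L ->
  volume (packing_union r L `&` eball 0 T) = (covered_volume r L T)%:E.
Proof.
move=> r0 T0 PL; have mU := vmeasurable_packing_union T r0 PL.
rewrite /covered_volume fineK// ge0_fin_numE ?volume_ge0//.
apply: (@le_lt_trans _ _ (volume (eball (0 : V) T))).
  by apply: le_volume => //; exact: vmeasurable_eball.
by rewrite volume_eball// ltry.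
Qed.

Lemma covered_volume_le r L T : 0 < r -> 0 < T -> packing r L ->
  covered_volume r L T <= T ^+ n * v.
Proof.
move=> r0 T0 PL; rewrite -lee_fin -covered_volumeE// -(volume_eball (0 : V) T0).
apply: le_volume; first exact: vmeasurable_packing_union.
  exact: vmeasurable_eball.
by move=> x [].
Qed.

Lemma density_quotientE r L T : 0 < r -> 0 < T -> packing r L ->
  (volume (packing_union r L `&` eball 0 T) / volume (eball (0 : V) T))%E =
  (covered_volume r L T / (T ^+ n * v))%:E.
Proof.
move=> r0 T0 PL; rewrite covered_volumeE// volume_eball// inver.
by rewrite gt_eqF ?EFinM// mulr_gt0 ?exprn_gt0// unit_ball_volume_gt0.
Qed.

(** Centers are counted after scaling [L'] by [r / r']. The [4 * r] consists of [r] for balls that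
    straddle the boundary of [eball 0 T], [2 * r] for the saturation margin, and [r] to contain the
    balls of [L] entirely. *)
Lemma covered_volume_saturated r L r' L' T : 0 < r -> 0 < r' -> 0 < T ->
  packing r L -> completely_saturated r L -> packing r' L' ->
  covered_volume r' L' T / r' ^+ n <=
  covered_volume r L (r / r' * T + 4 * r) / r ^+ n.
Proof.
move=> r0 r'0 T0 PL sL PL'; set a := r / r'; set T' := a * T + 4 * r.
have a0 : 0 < a by rewrite divr_gt0.
have aT : 0 < a * T by rewrite mulr_gt0.
have T'0 : 0 < T' by rewrite /T'; lra.
have ar : a * r' = r by rewrite /a divfK// gt_eqF.
have [P PL'E] := packing_finite_eball (T + r') r'0 PL'.
have PL'' p : p \in P -> (L' `&` eball 0 (T + r')) p by rewrite -PL'E.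
have [Q QLE] := packing_finite_eball (a * (T + r') + 2 * r) r0 PL.
have QL p : p \in Q -> (L `&` eball 0 (a * (T + r') + 2 * r)) p by rewrite -QLE.
pose P1 := [fset (a *: p)%R | p in P]%fset.
have PQ : (#|` P| <= #|` Q|)%N.
  have <- : #|` P1| = #|` P|.
    by rewrite card_imfset//; apply: scalerI; rewrite gt_eqF.
  apply: saturated_card_ge QLE => //.
    move=> _ _ /imfsetP[p /= pP ->] /imfsetP[q /= qP ->] pq.
    rewrite -scalerBr enormZ gtr0_norm// -ar mulrCA ler_pM2l//.
    apply: PL'; [by have [] := PL'' _ pP|by have [] := PL'' _ qP|].
    by move=> e; apply: pq; rewrite e.
  move=> _ /imfsetP[p /= /PL''[_ pT] ->]; move: pT.
  by rewrite /eball/= !subr0 enormZ gtr0_norm// ler_pM2l.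
have up : covered_volume r' L' T <= #|` P|%:R * (r' ^+ n * v).
  rewrite -lee_fin -covered_volumeE//; apply: volume_eball_cover => //.
    exact: vmeasurable_packing_union.
  by rewrite (packing_union_eball PL'E); exact: subIsetl.
have low : #|` Q|%:R * (r ^+ n * v) <= covered_volume r L T'.
  apply: (volume_packing r0 _ (vmeasurable_packing_union T' r0 PL)
    (covered_volumeE r0 T'0 PL)).
    by apply: packing_sub PL => p /QL[].
  move=> p /QL[Lp pT] x xp; split.
    exists p => //; exists (x - p); last by rewrite addrC subrK.
    by rewrite /eball/= subr0.
  have T'E : a * (T + r') + 2 * r = T' - r by rewrite /T' mulrDr ar; lra.
  by rewrite T'E in pT; exact: eball_sub pT _ xp.
apply: (@le_trans _ _ (#|` P|%:R * v)).
  by rewrite ler_pdivrMr ?exprn_gt0// -mulrA [v * _]mulrC.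
apply: (@le_trans _ _ (#|` Q|%:R * v)).
  by rewrite ler_pM2r ?ler_nat// unit_ball_volume_gt0.
by rewrite ler_pdivlMr ?exprn_gt0// -mulrA [v * _]mulrC.
Qed.

(** The additive [4 * r] in the radius changes volumes by a factor tending to [1], so the comparison
    of covered volumes passes to the upper limits. *)
Lemma density_le_saturated r L r' L' : 0 < r -> 0 < r' ->
  packing r L -> completely_saturated r L -> packing r' L' ->
  (density r' L' <= density r L)%E.
Proof.
move=> r0 r'0 PL sL PL'; rewrite [leRHS]/density limf_esupE.
have a0 : 0 < r / r' by rewrite divr_gt0.
apply: le_ereal_inf_tmp => _ [W [M [Mreal MW]] <-].
apply/lee_addgt0Pr => e e0.
(* For [T > N] the three terms give, in order, [3 ^ n * u <= e], [u <= 1] and [T'] in [W], where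
   [u = 4 * r' / T]. *)
pose N := (3 ^ n)%:R * (4 * r') / e + 4 * r' + `|M| / (r / r').
have N1 : 0 <= (3 ^ n)%:R * (4 * r') / e.
  by rewrite divr_ge0 ?mulr_ge0 ?(ltW e0) ?(ltW r'0).
have N2 : 0 <= `|M| / (r / r') by rewrite divr_ge0// ltW.
apply: ge_ereal_inf.
exists (ereal_sup ((fun T => volume (packing_union r' L' `&` eball 0 T) /
    volume (eball (0 : V) T))%E @` [set T | N < T])).
  by exists [set T | N < T] => //; exists N; split => //; exact: num_real.
apply: ge_ereal_sup => _ [T /= NT <-].
have T0 : 0 < T by rewrite /N in NT; lra.
pose T' := r / r' * T + 4 * r.
have aT0 : 0 < r / r' * T by rewrite mulr_gt0.
have T'0 : 0 < T' by rewrite /T'; lra.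
have WT' : W T'.
  apply: MW; apply: (@le_lt_trans _ _ `|M|); first exact: ler_norm.
  have : `|M| / (r / r') < T by rewrite /N in NT; lra.
  by rewrite ltr_pdivrMr// /T'; lra.
apply: (@le_trans _ _ ((covered_volume r L T' / (T' ^+ n * v))%:E + e%:E)%E);
  last first.
  apply: leeD => //; apply: ereal_sup_ubound; exists T' => //.
  exact: density_quotientE.
rewrite density_quotientE// -EFinD lee_fin.
have v0 := unit_ball_volume_gt0 R n.
set f := covered_volume r L T' / (T' ^+ n * v).
have f1 : f <= 1.
  rewrite ler_pdivrMr ?mulr_gt0 ?exprn_gt0// mul1r.
  exact: covered_volume_le.
have f0 : 0 <= f.
  rewrite divr_ge0//; last by rewrite ltW// mulr_gt0// exprn_gt0.
  rewrite /covered_volume fine_ge0// volume_ge0//.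
  exact: vmeasurable_packing_union.
(* The quotient at [T] exceeds the one at [T' = r / r' * T * (1 + u)] by at most
   [3 ^ n * u], and [u] tends to [0]. *)
pose u := 4 * r' / T.
have u0 : 0 <= u by rewrite divr_ge0 ?ltW// mulr_gt0.
have u1 : u <= 1 by rewrite ler_pdivrMr// mul1r; rewrite /N in NT; lra.
have T'u : T' = r / r' * T * (1 + u).
  by rewrite /T' /u; field; rewrite !gt_eqF.
apply: (@le_trans _ _ (f * (1 + u) ^+ n)).
  have := covered_volume_saturated r0 r'0 T0 PL sL PL'; rewrite -/T' => cv.
  have -> : f * (1 + u) ^+ n =
      covered_volume r L T' / r ^+ n * (r' ^+ n / (T ^+ n * v)).
    rewrite /f {2}T'u !exprMn exprVn.
    have U0 : (1 + u) ^+ n != 0 by rewrite expf_neq0// gt_eqF// ltr_pwDl.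
    have r0' : r ^+ n != 0 by rewrite expf_neq0// gt_eqF.
    have r0'' : r' ^+ n != 0 by rewrite expf_neq0// gt_eqF.
    have T00 : T ^+ n != 0 by rewrite expf_neq0// gt_eqF.
    have v00 : v != 0 by rewrite gt_eqF.
    move: U0 r0' r0'' T00 v00.
    move: (_ ^+ n) (r ^+ n) (r' ^+ n) (T ^+ n) => U x y z *; field.
    by do ?(apply/andP; split).
  rewrite -ler_pdivrMr ?divr_gt0 ?mulr_gt0 ?exprn_gt0//.
  apply: le_trans cv; rewrite invf_div mulrA divfK//.
  by rewrite gt_eqF// mulr_gt0// exprn_gt0.
apply: (@le_trans _ _ (f * (1 + (3 ^ n)%:R * u))).
  by rewrite ler_wpM2l// exprD1_le// u0.
rewrite mulrDr mulr1 lerD2l.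
apply: (@le_trans _ _ ((3 ^ n)%:R * u)); first by rewrite ler_piMl// mulr_ge0.
rewrite /u mulrA ler_pdivrMr// [e * T]mulrC -ler_pdivrMr// ltW//.
by rewrite /N in NT; lra.
Qed.

End Density.

Theorem theorem2p5 (R : realType) (n : nat) (r : R) :
  (0 < n)%N -> 0 < r ->
  exists L : set 'rV[R]_n,
    [/\ packing r L, completely_saturated r L &
        density r L = packing_constant R n].
Proof.
move=> _ r0; have [L [PL sL]] := exists_completely_saturated n r0.
exists L; split => //; apply/le_anti/andP; split.
  by apply: ereal_sup_ubound; exists r, L.
by apply: ge_ereal_sup => _ [r' [L' [r'0 PL' ->]]]; exact: density_le_saturated.
Qed.
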